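(* Let $\mu\in\mathbb{R}$ be the true parameter of the mixed logistic model with crossed random effects described in the context, with responses $y_{ij}$, $1\le i\le m$, $1\le j\le n$. Then, as $m,n\to\infty$ (that is, $m\wedge n\to\infty$), there is, with probability tending to one, a root $\hat\mu$ to the likelihood equation $\frac{\partial}{\partial\lambda}\log p_\lambda(y)=0$ such that $\hat\mu\stackrel{\mathrm{P}}{\longrightarrow}\mu$.
   Context: Model. For positive integers $m,n$, let $u_1,\dots,u_m,v_1,\dots,v_n$ be independent $N(0,1)$ random variables (unobserved random effects; their variances are known and equal to $1$). Given $u=(u_i)_{1\le i\le m}$ and $v=(v_j)_{1\le j\le n}$, the binary ($\{0,1\}$-valued) responses $y_{ij}$, $1\le i\le m$, $1\le j\le n$, are conditionally independent with $$\mathrm{logit}\{\mathrm{P}(y_{ij}=1\mid u,v)\}=\mu+u_i+v_j,\qquad \mathrm{logit}(p)=\log\{p/(1-p)\},\ p\in(0,1).$$ The only unknown parameter is $\mu\in\mathbb{R}$. Write $y=(y_{ij})_{1\le i\le m,1\le j\le n}$, and for $\lambda\in\mathbb{R}$ let $p_\lambda(y)$ denote the (marginal, i.e., unconditional on the random effects) probability mass function of $y$ when the true parameter is $\lambda$; as a function of $\lambda$ at the observed data it is the likelihood function. Convergence in probability and ''probability tending to one'' are under the true parameter $\mu$. Notation: $m\wedge n=\min(m,n)$. *)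

(* Defs.v *)
From HB Require Import structures.
From mathcomp Require Import all_boot all_order all_algebra.
From mathcomp Require Import all_classical all_reals all_analysis.

Set Implicit Arguments.
Unset Strict Implicit.
Unset Printing Implicit Defensive.

Import Order.TTheory GRing.Theory Num.Theory.
Import numFieldNormedType.Exports.

Local Open Scope classical_set_scope.
Local Open Scope ring_scope.

Definition logit (R : realType) (p : R) : R := ln (p / (1 - p)).

(* The family is finite and some of the [A k] may be the whole space, so the
   product rule for all of [I] contains the one for every subfamily. *)
Definition mutually_independent (R : realType) (d : measure_display)
    (T : measurableType d) (P : probability T R)
    (d' : measure_display) (T' : measurableType d')
    (I : finType) (X : I -> {mfun T >-> T'}) : Prop :=
  forall A : I -> set T', (forall k, measurable (A k)) ->
  P (\bigcap_k (X k @^-1` A k)) = (\prod_(k : I) P (X k @^-1` A k))%E.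

Definition sigma_generated (d : measure_display) (T : measurableType d)
    (d' : measure_display) (T' : measurableType d')
    (I : Type) (X : I -> {mfun T >-> T'}) : set (set T) :=
  <<s \bigcup_k g_sigma_algebra_preimage (X k) >>.

(* [q] is a version of the conditional probability P(A | G). *)
Definition is_cond_prob (R : realType) (d : measure_display)
    (T : measurableType d) (P : probability T R)
    (G : set (set T)) (A : set T) (q : T -> R) : Prop :=
  [/\ g_sigma_algebra_preimage q `<=` G,
      P.-integrable setT (EFin \o q) &
      forall B, G B -> P (A `&` B) = (\int[P]_(w in B) (q w)%:E)%E].

Definition cond_independent (R : realType) (d : measure_display)
    (T : measurableType d) (P : probability T R) (G : set (set T))
    (d' : measure_display) (T' : measurableType d')
    (I : finType) (X : I -> {mfun T >-> T'}) : Prop :=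
  forall (A : I -> set T') (q : I -> T -> R),
  (forall k, measurable (A k)) ->
  (forall k, is_cond_prob P G (X k @^-1` A k) (q k)) ->
  is_cond_prob P G (\bigcap_k (X k @^-1` A k)) (fun w => \prod_(k : I) q k w).

Definition effects (R : realType) (d : measure_display) (T : measurableType d)
    (m n : nat) (u : 'I_m -> {mfun T >-> R}) (v : 'I_n -> {mfun T >-> R})
    (k : 'I_m + 'I_n) : {mfun T >-> R} :=
  match k with inl i => u i | inr j => v j end.

(* Conditional probabilities are determined only almost surely, hence the
   choice of a version in [responses_logit]. *)
Record crossed_logistic_model (R : realType) (lambda : R)
    (d : measure_display) (T : measurableType d) (P : probability T R)
    (m n : nat) (u : 'I_m -> {mfun T >-> R}) (v : 'I_n -> {mfun T >-> R})
    (y : 'I_m -> 'I_n -> {mfun T >-> bool}) : Prop := {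
  effects_independent : mutually_independent P (effects u v) ;
  effects_normal : forall (k : 'I_m + 'I_n) (A : set R), measurable A ->
    distribution P (effects u v k) A = normal_prob 0 1 A ;
  responses_cond_independent :
    cond_independent P (sigma_generated (effects u v))
      (fun ij : 'I_m * 'I_n => y ij.1 ij.2) ;
  responses_logit : forall (i : 'I_m) (j : 'I_n), exists q : T -> R,
    is_cond_prob P (sigma_generated (effects u v)) [set w | y i j w = true] q /\
    forall w, 0 < q w < 1 /\ logit (q w) = lambda + u i w + v j w }.

Definition responses (d : measure_display) (T : measurableType d) (m n : nat)
    (y : 'I_m -> 'I_n -> {mfun T >-> bool}) (w : T) : 'M[bool]_(m, n) :=
  \matrix_(i, j) y i j w.

(* [P lambda] is the law when the true parameter is [lambda]. *)
Definition likelihood (R : realType) (d : measure_display)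
    (T : measurableType d) (P : R -> probability T R) (m n : nat)
    (y : 'I_m -> 'I_n -> {mfun T >-> bool}) (y0 : 'M[bool]_(m, n))
    (lambda : R) : R :=
  fine (P lambda [set w | responses y w = y0]).

(* [is_derive] asserts differentiability along with the value of the
   derivative, which [derive1] alone would not. *)
Definition likelihood_root (R : realType) (d : measure_display)
    (T : measurableType d) (P : R -> probability T R) (m n : nat)
    (y : 'I_m -> 'I_n -> {mfun T >-> bool}) (y0 : 'M[bool]_(m, n))
    (x : R) : Prop :=
  is_derive x 1 (fun lambda : R => ln (likelihood P y y0 lambda)) 0.

(* Main.v *)
Require Import Defs.
From HB Require Import structures.
From mathcomp Require Import all_boot all_order all_algebra.
From mathcomp Require Import all_classical all_reals all_analysis.
From mathcomp Require Import measurable_realfun.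
From mathcomp Require Import ring lra.
Import Order.TTheory GRing.Theory Num.Theory.
Import numFieldNormedType.Exports.
Local Open Scope classical_set_scope.
Local Open Scope ring_scope.

(** The likelihood at [lambda] is the mass that [P lambda] gives to the observed
    response matrix. To see that it is, with high probability, larger at [mu]
    than at a given [lambda <> mu], let [B] be any set of response matrices. On
    [B], wherever the likelihood at [mu] is at most that at [lambda], the mass
    under [mu] is at most the mass under [lambda]; so the event that [mu] does
    not beat [lambda] has [P mu]-probability at most
    [P mu (~ B) + P lambda B]. It thus suffices to have a consistent test of [mu]
    against [lambda], and the test may look at a subset of the data only. The
    diagonal responses [y i i], [i < minn m n], depend on disjoint pairs of
    random effects. They are therefore independent, with success probability
    [success_rate lambda], the mean of [sigmoid (lambda + a + b)] over
    independent standard normal [a] and [b], which is strictly increasing in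
    [lambda] ([success_rate_lt]). By Chebyshev's inequality their frequency gives
    a test with both errors of order [1 / minn m n] ([likelihood_comparison],
    fed by [response_rate] and [two_responses_rate]).

    Taking [lambda = mu - eps] and [lambda = mu + eps], the likelihood at [mu]
    exceeds, with probability tending to one, its values at both ends of
    [[mu - eps, mu + eps]]. It is differentiable, so its maximum over this
    interval is an interior critical point ([log_critical_point],
    [no_root_near_prob]). Differentiability comes from a formula for the
    likelihood: since the laws [P lambda] agree on the sigma-algebra generated by
    the random effects, conditional independence writes the likelihood as the
    integral, against a measure that does not depend on [lambda], of a product of
    logistic functions of [lambda] ([answers_probE], [derivable_answers_prob]).

    The root so obtained depends on [eps]. One estimator that serves every [eps]
    is a root whose distance to [mu] is within [1 / (minn m n + 1)] of the
    infimum of such distances ([nearest_within]). *)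

(** * Pairs taken from an independent family *)

(** Rectangles form a pi-system that generates the product sigma-algebra.
    Unlike uniqueness of the product measure, this also compares two measures
    neither of which is a priori a product. *)
Lemma measure_rectangle_unique (R : realType) (d1 d2 : measure_display)
    (T1 : measurableType d1) (T2 : measurableType d2)
    (m1 m2 : {measure set (T1 * T2) -> \bar R}) :
  (m1 setT < +oo)%E ->
  (forall A B, measurable A -> measurable B -> m1 (A `*` B) = m2 (A `*` B)) ->
  forall C, measurable C -> m1 C = m2 C.
Proof.
move=> m1oo m12 C mC.
pose G := [set A `*` B | A in @measurable _ T1 & B in @measurable _ T2].
apply: (measure_unique G (fun=> setT)) => //.
- exact: measurable_prod_measurableType.
- move=> _ _ [A mA [B mB <-]] [A' mA' [B' mB' <-]]; rewrite -setXI.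
  exists (A `&` A'); first exact: measurableI.
  by exists (B `&` B') => //; exact: measurableI.
- by move=> _; exists setT => //; exists setT => //; rewrite setXTT.
- by rewrite bigcup_const.
- by move=> _ [A mA [B mB <-]]; exact: m12.
Qed.

Section independent_family.
Context {R : realType} {d : measure_display} {T : measurableType d}
  {I : finType} {X : I -> {mfun T >-> R}}.

Definition pair_of (i j : I) (w : T) : R * R := (X i w, X j w).

Lemma measurable_pair_of i j : measurable_fun setT (pair_of i j).
Proof. exact: measurable_fun_pair. Qed.

Lemma measurable_preimage_pair_of i j C :
  measurable C -> measurable (pair_of i j @^-1` C).
Proof.
by move=> mC; rewrite -[X in measurable X]setTI; exact: measurable_pair_of.
Qed.

Context {P : probability T R} {nu : probability R R}.
Hypothesis indep : mutually_independent P X.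
Hypothesis law : forall i A, measurable A -> P (X i @^-1` A) = nu A.

Lemma cylinder_law (A : I -> set R) : (forall i, measurable (A i)) ->
  P (\bigcap_i (X i @^-1` A i)) = (\prod_(i : I) nu (A i))%E.
Proof. by move=> mA; rewrite indep//; apply: eq_bigr => i _; rewrite law. Qed.

(** The product rule for a subfamily is the one for the whole family with the
    full line as the event of every other variable. *)
Lemma subfamily_law (s : seq I) (A : I -> set R) : uniq s ->
  (forall i, measurable (A i)) ->
  P (\bigcap_(i in [set` s]) (X i @^-1` A i)) = (\prod_(i <- s) nu (A i))%E.
Proof.
move=> us mA.
pose A' i := if i \in s then A i else setT.
transitivity (P (\bigcap_i (X i @^-1` A' i))).
  congr (P _); apply/seteqP; split => w Aw i.
    by move=> _; rewrite /A' /=; case: ifPn => // /Aw.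
  by move=> /= si; have := Aw i Logic.I; rewrite /A' si.
rewrite cylinder_law; last by move=> i; rewrite /A'; case: ifP.
rewrite (bigID (mem s))/= [X in (_ * X)%E]big1 ?mule1; last first.
  by move=> i /negbTE si; rewrite /A' si probability_setT.
rewrite big_uniq//=; apply: eq_bigr => i si.
by rewrite /A' si.
Qed.

(** The event [E] rides along: carrying it through the uniqueness of measures
    on rectangles lets the same lemma be applied first to one pair and then, with
    [E] an arbitrary event of that pair, to the other. *)
Lemma pair_law_on i j (E : set T) : measurable E ->
  (forall A B, measurable A -> measurable B ->
     P (X i @^-1` A `&` X j @^-1` B `&` E) = (nu A * nu B * P E)%E) ->
  forall C, measurable C ->
  P (pair_of i j @^-1` C `&` E) = ((nu \x nu)%E C * P E)%E.
Proof.
move=> mE rect C mC.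
have PE : P E \is a fin_num by exact: fin_num_measure.
pose c := NngNum (fine_ge0 (measure_ge0 P E)).
transitivity (pushforward (mrestr P mE) (pair_of i j) C); first by [].
rewrite (@measure_rectangle_unique R _ _ _ _
  (pushforward (mrestr P mE) (pair_of i j)) (mscale c (nu \x nu)%E))//=.
- by rewrite /mscale/= fineK// muleC.
- exact: measurable_pair_of.
- move=> mp; rewrite /pushforward/= /mrestr preimage_setT setTI.
  by rewrite (le_lt_trans (probability_le1 _ _)) ?ltry.
- move=> mp A B mA mB; rewrite /mscale/= product_measure1E// fineK// muleC.
  by rewrite -rect//; congr (P _); apply/seteqP; split => w; rewrite /pair_of/=; tauto.
Qed.

Lemma pair_law i j C : i != j -> measurable C ->
  P (pair_of i j @^-1` C) = (nu \x nu)%E C.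
Proof.
move=> ij mC; rewrite -[X in P X]setIT pair_law_on//.
  by rewrite probability_setT mule1.
move=> A B mA mB; rewrite probability_setT mule1 setIT.
have := @subfamily_law [:: i; j] (fun k => if k == i then A else B).
rewrite /= inE ij => /(_ erefl); rewrite !big_cons big_nil mule1 eqxx eq_sym.
rewrite (negbTE ij) => <-; last by move=> k; case: ifP.
congr (P _); apply/seteqP; split => w /=.
  move=> [Ai Bj] k /=; rewrite !inE.
  by move=> /orP[]/eqP ->; rewrite ?eqxx// eq_sym (negbTE ij).
move=> H; split; first by have := H i; rewrite /= !inE eqxx; exact.
by have := H j; rewrite /= !inE eqxx orbT eq_sym (negbTE ij); exact.
Qed.

(** Independence of disjoint pairs: rectangles are upgraded to measurable sets
    of the plane one pair at a time, by two uses of [pair_law_on]. *)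
Lemma two_pairs_law i j k l C D : uniq [:: i; j; k; l] ->
  measurable C -> measurable D ->
  P (pair_of i j @^-1` C `&` pair_of k l @^-1` D) =
  ((nu \x nu)%E C * (nu \x nu)%E D)%E.
Proof.
move=> us mC mD.
have [ij kl] : i != j /\ k != l.
  by move: us; rewrite /= !inE !negb_or => /and4P[/andP[? _] _ ? _].
rewrite -(@pair_law k l D kl mD) pair_law_on//.
  exact: measurable_preimage_pair_of.
move=> A B mA mB; rewrite setIC.
have mE : measurable (X i @^-1` A `&` X j @^-1` B).
  by apply: measurableI; rewrite -[X in measurable X]setTI; exact: measurable_funPT.
have rect : P (X i @^-1` A `&` X j @^-1` B) = (nu A * nu B)%E.
  by rewrite -product_measure1E// -(pair_law i j)//; exact: measurableX.
rewrite pair_law_on//; first by rewrite rect muleC pair_law.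
move=> A' B' mA' mB'; rewrite rect.
pose F m := if m == i then A else if m == j then B else
            if m == k then A' else B'.
have [Fi Fj Fk Fl] : [/\ F i = A, F j = B, F k = A' & F l = B'].
  move: us; rewrite /F /= !inE !negb_or => /and4P[/and3P[a b c] /andP[e f] g _].
  have [b' c' e' f' g'] : [/\ k != i, l != i, k != j, l != j & l != k].
    by split; rewrite eq_sym.
  rewrite !eqxx (negbTE b') (negbTE c') (negbTE e') (negbTE f') (negbTE g').
  by rewrite eq_sym (negbTE a).
have := @subfamily_law [:: i; j; k; l] F us.
rewrite !big_cons big_nil mule1 Fi Fj Fk Fl => FE.
rewrite [RHS]muleC -[RHS]muleA -FE; last first.
  by move=> m; rewrite /F; repeat case: ifP => // _.
congr (P _); apply/seteqP; split => w /=.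
  by move=> [[? ?] [? ?]] m /=; rewrite !inE => /or4P[]/eqP ->; rewrite ?Fi ?Fj ?Fk ?Fl.
move=> H; split; split.
- by rewrite /= -Fk; apply: H; rewrite /= !inE eqxx ?orbT.
- by rewrite /= -Fl; apply: H; rewrite /= !inE eqxx ?orbT.
- by rewrite /= -Fi; apply: H; rewrite /= !inE eqxx ?orbT.
- by rewrite /= -Fj; apply: H; rewrite /= !inE eqxx ?orbT.
Qed.

End independent_family.

(** The joint law of [Z1] and [Z2] is the product measure [N \x N], over which
    the integral splits by Tonelli. *)
Lemma independent_expectation (R : realType) (d d' : measure_display)
    (T : measurableType d) (T' : measurableType d')
    (P : probability T R) (N : probability T' R) (Z1 Z2 : T -> T') (g : T' -> R) :
  measurable_fun setT Z1 -> measurable_fun setT Z2 ->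
  (forall C D, measurable C -> measurable D ->
     P (Z1 @^-1` C `&` Z2 @^-1` D) = (N C * N D)%E) ->
  measurable_fun setT g -> (forall z, 0 <= g z) ->
  (\int[P]_w (g (Z1 w) * g (Z2 w))%:E =
   (\int[N]_z (g z)%:E) * (\int[N]_z (g z)%:E))%E.
Proof.
move=> mZ1 mZ2 joint mg g0.
pose Z w := (Z1 w, Z2 w).
pose h (z : T' * T') := (g z.1 * g z.2)%:E.
have mZ : measurable_fun setT Z by exact: measurable_fun_pair.
have mh : measurable_fun setT h.
  by apply/measurable_EFinP/measurable_funM; apply: measurableT_comp.
have h0 z : (0 <= h z)%E by rewrite lee_fin mulr_ge0.
transitivity (\int[pushforward P Z]_z h z)%E.
  by rewrite ge0_integral_pushforward.
transitivity (\int[N \x N]_z h z)%E.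
  apply: eq_measure_integral => C mC _.
  have P1 : (pushforward P Z setT < +oo)%E.
    by rewrite /pushforward preimage_setT probability_setT ltry.
  refine (@measure_rectangle_unique R _ _ _ _ _ _ P1 _ C mC) => A B mA mB /=.
  by rewrite product_measure1E//= -joint.
rewrite fubini_tonelli1//.
have gE z : (0 <= (g z)%:E)%E by rewrite lee_fin.
have mgE : measurable_fun setT (EFin \o g) by exact/measurable_EFinP.
rewrite -ge0_integralZr//; last exact: integral_ge0.
by apply: eq_integral => z _; rewrite /fubini_F/h/= -ge0_integralZl//.
Qed.

Section pair_expectation.
Context {R : realType} {d : measure_display} {T : measurableType d}
  {I : finType} {X : I -> {mfun T >-> R}}
  {P : probability T R} {nu : probability R R}.
Hypothesis indep : mutually_independent P X.
Hypothesis law : forall i A, measurable A -> P (X i @^-1` A) = nu A.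
Context {g : R * R -> R}.
Hypotheses (mg : measurable_fun setT g) (g0 : forall z, 0 <= g z).

Lemma pair_expectation i j : i != j ->
  (\int[P]_w (g (X i w, X j w))%:E = \int[nu \x nu]_z (g z)%:E)%E.
Proof.
move=> ij.
transitivity (\int[pushforward P (@pair_of _ _ _ _ X i j)]_z (g z)%:E)%E.
  rewrite ge0_integral_pushforward//=; first exact: measurable_pair_of.
    exact/measurable_EFinP.
  by move=> z _; rewrite lee_fin.
apply: eq_measure_integral => [|mp C mC _]; first exact: measurable_pair_of.
exact: pair_law.
Qed.

Lemma two_pairs_expectation i j k l : uniq [:: i; j; k; l] ->
  (\int[P]_w (g (X i w, X j w) * g (X k w, X l w))%:E =
   (\int[nu \x nu]_z (g z)%:E) * (\int[nu \x nu]_z (g z)%:E))%E.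
Proof.
move=> us.
apply: (@independent_expectation _ _ _ _ _ P (nu \x nu)%E
  (pair_of i j) (pair_of k l)) => //.
- exact: measurable_pair_of.
- exact: measurable_pair_of.
- by move=> C D; exact: two_pairs_law.
Qed.

End pair_expectation.

Section law_determines.
Context {R : realType} {d : measure_display} {T : measurableType d}
  {I : finType} {X : I -> {mfun T >-> R}}
  {P Q : probability T R} {nu : probability R R}.
Hypotheses (indepP : mutually_independent P X)
           (indepQ : mutually_independent Q X).
Hypothesis lawP : forall i A, measurable A -> P (X i @^-1` A) = nu A.
Hypothesis lawQ : forall i A, measurable A -> Q (X i @^-1` A) = nu A.

(** The cylinders are a pi-system that generates the sigma-algebra of the family,
    and their probabilities only involve the common law [nu]. *)
Lemma sigma_generated_law_unique A : sigma_generated X A -> P A = Q A.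
Proof.
pose G := [set B | exists2 F : I -> set R, (forall i, measurable (F i)) &
                   B = \bigcap_i (X i @^-1` F i)].
have mX i (F : set R) : measurable F -> measurable (X i @^-1` F).
  by move=> mF; rewrite -[X in measurable X]setTI; exact: measurable_funPT.
move=> XA; apply: (g_sigma_algebra_measure_unique G _ (fun=> setT)) => //.
- move=> _ [F mF ->]; apply: fin_bigcap_measurable => // i _; exact: mX.
- move=> _; exists (fun=> setT) => //.
  by apply/seteqP; split.
- by rewrite bigcup_const.
- move=> _ _ [F mF ->] [F' mF' ->]; exists (fun i => F i `&` F' i).
    by move=> i; exact: measurableI.
  by rewrite -bigcapI.
- move=> _ [F mF ->].
  apply: etrans (cylinder_law indepP lawP F mF) _.
  exact: esym (cylinder_law indepQ lawQ F mF).
- by move=> _; rewrite (le_lt_trans (probability_le1 _ _)) ?ltry.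
move: XA; apply: smallest_sub; first exact: smallest_sigma_algebra.
move=> B [i _ [F mF <-]]; apply: sub_sigma_algebra.
exists (fun j => if j == i then F else setT); first by move=> j; case: ifP.
rewrite setTI; apply/seteqP; split => w /=.
  by move=> Fw j _ /=; case: eqP => // ->.
by move=> /(_ i Logic.I)/=; rewrite eqxx.
Qed.

(** The image laws of [f] under [P] and [Q] coincide because preimages under [f]
    belong to the sigma-algebra on which [P] and [Q] agree. *)
Lemma sigma_generated_integral_unique (f : T -> R) :
  g_sigma_algebra_preimage f `<=` sigma_generated X -> (forall w, 0 <= f w) ->
  measurable_fun setT f ->
  (\int[P]_w (f w)%:E = \int[Q]_w (f w)%:E)%E.
Proof.
move=> fX f0 mf.
have E (M : probability T R) :
    (\int[M]_w (f w)%:E = \int[pushforward M f]_y `|y|%:E)%E.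
  rewrite ge0_integral_pushforward//=.
    by apply: eq_integral => w _ /=; rewrite ger0_norm.
  by apply/measurable_EFinP; exact: normr_measurable.
rewrite !E; apply: eq_measure_integral => B mB _.
apply: sigma_generated_law_unique; apply: fX.
by exists B => //; rewrite setTI.
Qed.

End law_determines.

(** * The logistic function and the success rate *)

Definition sigmoid {R : realType} (x : R) : R := (1 + expR (- x))^-1.

Lemma sigmoid_denom_gt0 (R : realType) (x : R) : 0 < 1 + expR (- x).
Proof. by rewrite addr_gt0// expR_gt0. Qed.

Lemma sigmoid_gt0 (R : realType) (x : R) : 0 < sigmoid x.
Proof. by rewrite invr_gt0 sigmoid_denom_gt0. Qed.

Lemma sigmoid_lt1 (R : realType) (x : R) : sigmoid x < 1.
Proof. by rewrite invf_lt1 ?sigmoid_denom_gt0// ltrDl expR_gt0. Qed.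

Lemma sigmoid_lt (R : realType) : {homo @sigmoid R : x y / x < y}.
Proof.
by move=> x y xy; rewrite ltf_pV2 ?posrE ?sigmoid_denom_gt0// ltrD2l ltr_expR ltrN2.
Qed.

(** Turns the model assumption, which is stated through [logit], into an explicit
    success probability. *)
Lemma logit_sigmoid (R : realType) (p t : R) :
  0 < p < 1 -> logit p = t -> p = sigmoid t.
Proof.
move=> /andP[p0 p1] <-; rewrite /sigmoid /logit expRN lnK; last first.
  by rewrite posrE divr_gt0 ?subr_gt0.
rewrite invf_div -[X in (X + _)^-1](divff (lt0r_neq0 p0)) -mulrDl.
by rewrite addrC subrK mul1r invrK.
Qed.

Lemma is_derive_sigmoid (R : realType) (x : R) :
  is_derive x 1 (@sigmoid R) (sigmoid x * (1 - sigmoid x)).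
Proof.
have H : is_derive x 1 (fun y : R => 1 + expR (- y)) (- expR (- x)).
  have H1 : is_derive x 1 (fun y : R => expR (- y)) (expR (- x) * -1).
    exact: is_derive1_comp.
  have H0 : is_derive (x : R) (1 : R) (cst 1 : R -> R) 0 by exact: is_derive_cst.
  by have := is_deriveD H0 H1; rewrite add0r mulrN1.
have d0 : 1 + expR (- x) != 0 by rewrite gt_eqF// sigmoid_denom_gt0.
apply: (is_derive_eq (@is_deriveV _ (fun y : R => 1 + expR (- y)) _ _ _ d0 H)).
rewrite /sigmoid /GRing.scale/=; field.
exact: d0.
Qed.

Lemma measurable_sigmoid (R : realType) : measurable_fun setT (@sigmoid R).
Proof.
apply: continuous_measurable_fun => x.
by apply/differentiable_continuous/derivable1_diffP; case: (is_derive_sigmoid R x).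
Qed.

(** By the Leibniz rule the derivative is a sum of [size s] terms, each a product
    of factors bounded by 1. The bound is uniform in [x], as needed to
    differentiate under an integral sign. *)
Lemma prod_derive_bounded (R : realType) (I : Type) (s : seq I)
    (f : I -> R -> R) (x : R) :
  (forall i, 0 <= f i x <= 1) ->
  (forall i, exists2 D, is_derive x 1 (f i) D & `|D| <= 1) ->
  exists2 D, is_derive x 1 (fun y => \prod_(i <- s) f i y) D & `|D| <= (size s)%:R.
Proof.
move=> f01 df.
have prod01 (t : seq I) : 0 <= \prod_(i <- t) f i x <= 1.
  elim/big_ind: _ => //=; first by rewrite ler01 lexx.
  move=> a b /andP[a0 a1] /andP[b0 b1].
  by rewrite mulr_ge0//= mulr_ile1.
elim: s => [|i s [D dD D1]].
  exists 0; last by rewrite normr0.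
  by under eq_fun do rewrite big_nil; exact: is_derive_cst.
have [Di dDi Di1] := df i.
exists (f i x *: D + (\prod_(j <- s) f j x) *: Di).
  under eq_fun do rewrite big_cons.
  exact: is_deriveM.
rewrite /GRing.scale/= (le_trans (ler_normD _ _))// !normrM.
have /andP[a0 a1] := f01 i; have /andP[b0 b1] := prod01 s.
rewrite -addn1 natrD lerD// -[leRHS]mul1r.
  by rewrite ler_pM// ger0_norm.
by rewrite mul1r -[leRHS]mulr1 ler_pM// ger0_norm.
Qed.

Definition mean_sigmoid {R : realType} {d : measure_display} {T : measurableType d}
    (N : probability T R) (h : T -> R) (lambda : R) : R :=
  \int[N]_z sigmoid (lambda + h z).

Lemma measurable_shifted_sigmoid (R : realType) (d : measure_display)
    (T : measurableType d) (h : T -> R) (lambda : R) :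
  measurable_fun setT h -> measurable_fun setT (fun z => sigmoid (lambda + h z)).
Proof.
move=> mh; apply: (measurableT_comp (measurable_sigmoid R)).
exact: measurable_funD.
Qed.

Lemma bounded01_integrable (R : realType) (d : measure_display)
    (T : measurableType d) (N : probability T R) (f : T -> R) :
  measurable_fun setT f -> (forall z, 0 <= f z <= 1) ->
  N.-integrable setT (EFin \o f).
Proof.
move=> mf f01; apply: measurable_bounded_integrable => //.
  by rewrite (le_lt_trans (probability_le1 _ _)) ?ltry.
exists 1; split => // x x1 z _ /=.
by have /andP[f0 f1] := f01 z; rewrite ger0_norm// (le_trans f1) ?ltW.
Qed.

Lemma sigmoid01 (R : realType) (x : R) : 0 <= sigmoid x <= 1.
Proof. by rewrite !ltW ?sigmoid_gt0 ?sigmoid_lt1. Qed.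

Lemma mean_sigmoidE (R : realType) (d : measure_display) (T : measurableType d)
    (N : probability T R) (h : T -> R) (lambda : R) : measurable_fun setT h ->
  (\int[N]_z (sigmoid (lambda + h z))%:E)%E = (mean_sigmoid N h lambda)%:E.
Proof.
move=> mh; rewrite /mean_sigmoid /Rintegral fineK//.
apply: (integrable_fin_num _ (bounded01_integrable _ _ _ _ _ _ _)) => //.
  exact: measurable_shifted_sigmoid.
by move=> z; exact: sigmoid01.
Qed.

(** The difference of the two means is the integral of a positive function; were
    it zero, the function would vanish almost everywhere. *)
Lemma mean_sigmoid_lt (R : realType) (d : measure_display) (T : measurableType d)
    (N : probability T R) (h : T -> R) : measurable_fun setT h ->
  {homo mean_sigmoid N h : x y / x < y}.
Proof.
move=> mh x y xy.
have ms l := measurable_shifted_sigmoid _ _ _ _ l mh.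
have int_s l : N.-integrable setT (EFin \o fun z => sigmoid (l + h z)).
  by apply: bounded01_integrable => // z; exact: sigmoid01.
pose f z := sigmoid (y + h z) - sigmoid (x + h z).
have f_gt0 z : 0 < f z by rewrite subr_gt0 sigmoid_lt// ltrD2r.
have mf : measurable_fun setT f by exact: measurable_funB.
rewrite -subr_gt0 /mean_sigmoid -RintegralB// lt_neqAle; apply/andP; split; last first.
  by apply: Rintegral_ge0 => z _; exact: (ltW (f_gt0 z)).
apply/eqP => /esym; rewrite /Rintegral => f0.
have int_f : N.-integrable setT (EFin \o f).
  have := integrableB measurableT (int_s y) (int_s x).
  by apply: eq_integrable => // z _.
have F0 : (\int[N]_z `|(f z)%:E| = 0)%E.
  rewrite (eq_integral (EFin \o f)); last first.
    by move=> z _; rewrite /= ger0_norm// ltW.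
  rewrite -(fineK (integrable_fin_num _ int_f))//.
  by congr EFin.
have mfE : measurable_fun setT (EFin \o f) by exact/measurable_EFinP.
have [Z [mZ NZ sub]] := (ae_eq_integral_abs N measurableT mfE).1 F0.
suff ZT : Z = [set: T].
  have := probability_setT N; rewrite -ZT => Z1.
  by move: NZ; rewrite [LHS]Z1 => /eqP; rewrite onee_eq0.
apply/seteqP; split => // z _; apply: sub => /= /(_ Logic.I) [] fz.
by have := f_gt0 z; rewrite fz ltxx.
Qed.

(** The normal law lives on the presentation of the Borel sigma-algebra by
    half-open intervals; the identity transports it to the structure carried by
    [R]. *)
Definition from_ocitv (R : realType) : measurableTypeR R -> R := idfun.

HB.instance Definition _ (R : realType) :=
  @isMeasurableFun.Build _ _ _ _ (from_ocitv R) (@measurable_id _ _ setT).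

Definition standard_normal (R : realType) : probability R R :=
  distribution (normal_prob 0 1 : probability (measurableTypeR R) R) (from_ocitv R).

(** The probability that a single response equals 1: its row and column effects
    are independent standard normal variables. *)
Definition success_rate {R : realType} (lambda : R) : R :=
  mean_sigmoid (standard_normal R \x standard_normal R)%E (fun z => z.1 + z.2) lambda.

Lemma success_rate_lt (R : realType) : {homo @success_rate R : x z / x < z}.
Proof. by apply: mean_sigmoid_lt; exact: measurable_funD. Qed.

(** * Comparing two probability mass functions by a test *)

(** Chebyshev's inequality for the number of events that occur among [k] events
    that have probability [r] and are pairwise independent under the mass
    function [p]: its variance is [k * (r - r ^+ 2)], at most [k]. *)
Lemma finite_chebyshev (R : realFieldType) (F : finType) (p : F -> R) (k : nat)
    (b : 'I_k -> pred F) (r delta : R) :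
  (forall y, 0 <= p y) -> \sum_y p y = 1 ->
  (forall i, \sum_(y | b i y) p y = r) ->
  (forall i j, i != j -> \sum_(y | b i y && b j y) p y = r ^+ 2) ->
  0 < delta -> (0 < k)%N ->
  \sum_(y | k%:R * delta <= `|\sum_i (b i y)%:R - k%:R * r|) p y
    <= (k%:R * delta ^+ 2)^-1.
Proof.
move=> p0 p1 pr prr d0 k0.
pose X i y : R := (b i y)%:R - r.
have k0R : 0 < k%:R :> R by rewrite ltr0n.
have EE (Q : pred F) : \sum_y p y * (Q y)%:R = \sum_(y | Q y) p y.
  by rewrite [RHS]big_mkcond; apply: eq_bigr => y _; case: (Q y); rewrite ?mulr1 ?mulr0.
have SX y : \sum_i (b i y)%:R - k%:R * r = \sum_i X i y.
  by rewrite sumrB sumr_const card_ord mulr_natl.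
have EX i j : \sum_y p y * (X i y * X j y) = if i == j then r - r ^+ 2 else 0.
  have -> : \sum_y p y * (X i y * X j y) =
      \sum_y p y * (b i y && b j y)%:R - r * (\sum_y p y * (b i y)%:R)
      - r * (\sum_y p y * (b j y)%:R) + r ^+ 2 * \sum_y p y.
    rewrite !mulr_sumr -!sumrB -big_split/=; apply: eq_bigr => y _.
    by rewrite /X -mulnb natrM; ring.
  rewrite !EE p1 !pr; case: eqP => [<-|/eqP ij]; last by rewrite prr//; ring.
  by under eq_bigl do rewrite andbb; rewrite pr; ring.
have var : \sum_y p y * (\sum_i X i y) ^+ 2 <= k%:R.
  have -> : \sum_y p y * (\sum_i X i y) ^+ 2 = \sum_i \sum_j \sum_y p y * (X i y * X j y).
    under [RHS]eq_bigr do rewrite exchange_big/=.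
    rewrite [RHS]exchange_big/=; apply: eq_bigr => y _.
    rewrite expr2 mulr_suml mulr_sumr; apply: eq_bigr => i _.
    by rewrite mulr_sumr mulr_sumr.
  rewrite (@le_trans _ _ (\sum_(i < k) 1))//; last by rewrite sumr_const card_ord.
  apply: ler_sum => i _; rewrite (bigD1 i)//= EX eqxx big1 ?addr0.
    (* In fact [r - r ^+ 2 <= 4^-1]. *)
    have : 0 <= (r - 2^-1) ^+ 2 by rewrite sqr_ge0.
    nra.
  by move=> j ji; rewrite EX eq_sym (negbTE ji).
have kd0 : 0 < k%:R * delta by rewrite mulr_gt0.
set bad := \sum_(y | _) p y.
have markov : bad * (k%:R * delta) ^+ 2 <= \sum_y p y * (\sum_i X i y) ^+ 2.
  rewrite /bad mulr_suml [leLHS]big_mkcond; apply: ler_sum => y _.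
  case: ifP => [|_]; last by rewrite mulr_ge0// sqr_ge0.
  rewrite SX => bady; rewrite ler_wpM2l//.
  by rewrite -[leRHS]real_normK ?num_real// lerXn2r// nnegrE ltW.
rewrite -[leRHS]mul1r ler_pdivlMr ?mulr_gt0 ?exprn_gt0//.
rewrite -(ler_pM2l k0R) mulr1 (le_trans _ (le_trans markov var))//.
by rewrite exprMn expr2 -mulrA mulrCA.
Qed.

(** The test that rejects [p] when the frequency of the events is at distance at
    least [delta = |r - s| / 2] from [r] has small error under both [p] and [q].
    Where it rejects, [p] has little mass; where it does not and [p y <= q y], the
    mass of [p] is at most that of [q], which is small there because the frequency
    is then at distance at least [delta] from [s]. *)
Lemma likelihood_comparison (R : realFieldType) (F : finType) (p q : F -> R)
    (k : nat) (b : 'I_k -> pred F) (r s : R) :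
  (forall y, 0 <= p y) -> (forall y, 0 <= q y) ->
  \sum_y p y = 1 -> \sum_y q y = 1 ->
  (forall i, \sum_(y | b i y) p y = r) -> (forall i, \sum_(y | b i y) q y = s) ->
  (forall i j, i != j -> \sum_(y | b i y && b j y) p y = r ^+ 2) ->
  (forall i j, i != j -> \sum_(y | b i y && b j y) q y = s ^+ 2) ->
  r != s -> (0 < k)%N ->
  \sum_(y | p y <= q y) p y <= 8 / (r - s) ^+ 2 / k%:R.
Proof.
move=> p0 q0 p1 q1 pr qs prr qss rs k0.
pose delta := `|r - s| / 2.
have d0 : 0 < delta by rewrite divr_gt0// normr_gt0 subr_eq0.
have Cp := finite_chebyshev _ _ p k b r delta p0 p1 pr prr d0 k0.
have Cq := finite_chebyshev _ _ q k b s delta q0 q1 qs qss d0 k0.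
pose N y : R := \sum_i (b i y)%:R.
have -> : 8 / (r - s) ^+ 2 / k%:R = (k%:R * delta ^+ 2)^-1 + (k%:R * delta ^+ 2)^-1.
  have k0R : k%:R != 0 :> R by rewrite pnatr_eq0 -lt0n.
  rewrite /delta expr_div_n real_normK ?num_real//.
  have rs0 : r - s != 0 by rewrite subr_eq0.
  by field; rewrite rs0 k0R.
apply: le_trans (lerD Cp Cq).
rewrite [leLHS]big_mkcond [X in _ <= X + _]big_mkcond.
rewrite [X in _ <= _ + X]big_mkcond -big_split/=.
apply: ler_sum => y _.
case: ifP => [pq|_]; last by rewrite addr_ge0//; case: ifP.
case: ifPn => [_|]; first by rewrite lerDl; case: ifP.
rewrite -ltNge => near_r; rewrite ifT ?add0r//.
have := ler_normD (k%:R * r - N y) (N y - k%:R * s).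
rewrite addrA subrK -mulrBr normrM (ger0_norm (ler0n _ _)) (distrC _ (N y)).
have -> : `|r - s| = delta + delta by rewrite /delta; field.
rewrite -/(N y) in near_r *; lra.
Qed.

(** * Critical points, nearest roots and limits *)

(** The maximum of [L] over the closed interval is not at an endpoint, so it is a
    critical point; there [L] is positive, as it exceeds a value of [L], which is
    nonnegative. *)
Lemma log_critical_point (R : realType) (L : R -> R) (mu eps : R) :
  (forall x, derivable L x 1) -> (forall x, 0 <= L x) -> 0 < eps ->
  L (mu - eps) < L mu -> L (mu + eps) < L mu ->
  exists2 c, `|c - mu| < eps & is_derive c 1 (fun x => ln (L x)) 0.
Proof.
move=> dL L0 e0 Ll Lr.
pose a := mu - eps; pose b := mu + eps.
have ab : a <= b by rewrite lerD2l ge0_cp// ltW.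
have cL : {within `[a, b], continuous L}.
  by apply: derivable_within_continuous => x _; exact: dL.
have [c cab cmax] := EVT_max ab cL.
have mu_ab : mu \in `[a, b] by rewrite in_itv/= gerBl lerDl ltW.
have Lmu_c := cmax _ mu_ab.
have c_ab : c \in `]a, b[.
  move: cab; rewrite !in_itv/= !le_eqVlt => /andP[/orP[/eqP ac|->] /orP[/eqP cb|->]] //.
  - by move: Lmu_c; rewrite -ac leNgt Ll.
  - by move: Lmu_c; rewrite -ac leNgt Ll.
  - by move: Lmu_c; rewrite cb leNgt Lr.
exists c; first by move: c_ab; rewrite in_itv/= ltr_distl.
have dc : is_derive c 1 L 0.
  apply: (derive1_at_max ab) => // x xab; apply: cmax.
  by apply: subset_itv_oo_cc xab.
have Lc0 : 0 < L c by apply: lt_le_trans Lmu_c; exact: le_lt_trans (L0 _) Ll.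
have := @is_derive1_comp R (@ln R) L c _ 0 (is_derive1_ln Lc0) dc.
by rewrite mulr0.
Qed.

(** The infimum of the distances from [mu] to points of [A] may fail to be
    attained when [A] is not closed, hence the tolerance. *)
Definition nearest_within {R : realType} (tol mu : R) (A : set R) : R :=
  xget 0 [set x | A x /\ forall z, A z -> `|x - mu| <= `|z - mu| + tol].

Lemma nearest_withinP (R : realType) (tol mu z : R) (A : set R) : 0 < tol -> A z ->
  A (nearest_within tol mu A) /\ `|nearest_within tol mu A - mu| <= `|z - mu| + tol.
Proof.
move=> tol0 Az; rewrite /nearest_within; case: xgetP => [x _ [Ax /(_ z Az)//]|none].
pose D := [set `|x - mu| | x in A].
have infD : has_inf D.
  split; first by exists `|z - mu|; exists z.
  by exists 0 => _ [x _ <-].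
have [_ [x Ax <-] xD] := inf_adherent tol0 infD.
exfalso; apply: (none x); split => // x' Ax'.
rewrite (le_trans (ltW xD))// lerD2r; apply: ge_inf; first by case: infD.
by exists x'.
Qed.

Lemma cvg_minn (R : realType) (f : nat * nat -> R) (C : R) (N : nat) :
  (forall m n, (N < m)%N -> (N < n)%N -> 0 <= f (m, n) <= C / (minn m n)%:R) ->
  f mn @[mn --> filter_prod \oo \oo] --> 0.
Proof.
move=> fC; apply/cvgrPdist_le => e e0.
pose K := maxn N (Num.truncn (`|C| / e)).
exists ([set m | (K < m)%N], [set n | (K < n)%N]) => /=.
  by split; exists K.+1.
move=> [m n] /= [Km Kn].
have [f0 fle] : 0 <= f (m, n) /\ f (m, n) <= C / (minn m n)%:R.
  apply/andP; apply: fC; first by apply: leq_ltn_trans Km; exact: leq_maxl.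
  by apply: leq_ltn_trans Kn; exact: leq_maxl.
rewrite sub0r normrN ger0_norm// (le_trans fle)//.
have Kmn : (K < minn m n)%N by rewrite leq_min Km Kn.
rewrite ler_pdivrMr ?ltr0n ?(leq_ltn_trans _ Kmn)// (le_trans (ler_norm _))//.
rewrite mulrC -ler_pdivrMr// (le_trans (ltW (truncnS_gt _)))// ler_nat.
by apply: leq_ltn_trans Kmn; exact: leq_maxr.
Qed.

(** * The crossed logistic model *)

Lemma sigma_algebra_setT (T : Type) (G : set (set T)) :
  sigma_algebra setT G -> G setT.
Proof. by move=> [G0 GC _]; rewrite -(setD0 setT); exact: GC. Qed.

(** Together with [is_cond_prob_setC], this gives versions of the conditional
    probabilities of all events of one response from that of a success. *)
Lemma is_cond_prob_setT (R : realType) (d : measure_display)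
    (T : measurableType d) (P : probability T R) (G : set (set T)) :
  sigma_algebra setT G -> G `<=` measurable -> is_cond_prob P G setT (fun=> 1).
Proof.
move=> sG Gm; have GT := sigma_algebra_setT _ _ sG.
split.
- move=> _ [B mB <-]; rewrite setTI preimage_cst; case: ifP => _ //.
  by have [] := sG.
- by apply: bounded01_integrable => // _; rewrite ler01 lexx.
- move=> B GB; rewrite setTI.
  by rewrite (integral_cst P (Gm _ GB) 1%:E) mul1e.
Qed.

Lemma is_cond_prob_setC (R : realType) (d : measure_display)
    (T : measurableType d) (P : probability T R) (G : set (set T))
    (A : set T) (q : T -> R) :
  G `<=` measurable -> measurable A -> is_cond_prob P G A q ->
  is_cond_prob P G (~` A) (fun w => 1 - q w).
Proof.
move=> Gm mA [qG int_q qE].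
have int1 : P.-integrable setT (EFin \o cst 1).
  by apply: bounded01_integrable => // z; rewrite /= ler01 lexx.
split.
- move=> _ [B mB <-]; apply: qG.
  exists ((fun x => 1 - x) @^-1` B) => //.
  have mf : measurable_fun setT (fun x : R => 1 - x) by exact: measurable_funB.
  by have := mf measurableT B mB; rewrite setTI.
- have := integrableB measurableT int1 int_q.
  by apply: eq_integrable.
- move=> B GB; have mB := Gm _ GB.
  have sB (f : T -> R) :
      P.-integrable setT (EFin \o f) -> P.-integrable B (EFin \o f).
    by apply: integrableS => //.
  transitivity (\int[P]_(w in B) ((1%:E) - (q w)%:E))%E; last first.
    by apply: eq_integral => w _; rewrite EFinB.
  rewrite (integralB mB (sB _ int1) (sB _ int_q)) -qE//.
  rewrite (integral_cst P mB 1%:E) mul1e.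
  rewrite setIC -setDE measureD// ?(le_lt_trans (probability_le1 _ _)) ?ltry//.
  by rewrite [in X in (_ - X)%E]setIC.
Qed.

(** A prescription for one binary response: [Some b] requires the value [b] and
    [None] leaves the response free. Families of prescriptions cover both the
    likelihood (all responses prescribed) and the laws of one or two responses. *)
Definition answer_set (a : option bool) : set bool :=
  if a is Some b then [set b] else setT.

Definition answer_prob {R : realType} (a : option bool) (p : R) : R :=
  if a is Some b then (if b then p else 1 - p) else 1.

Lemma answer_prob01 (R : realType) (a : option bool) (p : R) :
  0 <= p <= 1 -> 0 <= answer_prob a p <= 1.
Proof.
move=> /andP[p0 p1]; case: a => [[]|] /=.
- by rewrite p0.
- by rewrite subr_ge0 p1 gerBl.
- by rewrite ler01 lexx.
Qed.

Lemma derive_answer_prob_bounded (R : realType) (a : option bool) (t x : R) :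
  exists2 D, is_derive x 1 (fun y : R => answer_prob a (sigmoid (y + t))) D &
    `|D| <= 1.
Proof.
have [s0 s1] : 0 < sigmoid (x + t) /\ sigmoid (x + t) < 1.
  by split; [exact: sigmoid_gt0|exact: sigmoid_lt1].
pose D := sigmoid (x + t) * (1 - sigmoid (x + t)).
have D1 : `|D| <= 1.
  rewrite ger0_norm; last by rewrite mulr_ge0// ?subr_ge0 ltW.
  by rewrite mulr_ile1// ?subr_ge0 ?gerBl ltW.
have H : is_derive x 1 (fun y : R => sigmoid (y + t)) D.
  have Hs : is_derive x (1 : R) (fun y : R => y + t) 1.
    have H0 : is_derive (x : R) (1 : R) (cst t : R -> R) 0 by exact: is_derive_cst.
    by have := is_deriveD (is_derive_id x (1 : R)) H0; rewrite addr0.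
  have := @is_derive1_comp R sigmoid (fun y => y + t) x _ 1
    (is_derive_sigmoid R (x + t)) Hs.
  by rewrite mulr1.
case: a => [[]|] /=.
- by exists D.
- exists (- D); last by rewrite normrN.
  have H0 : is_derive (x : R) (1 : R) (cst 1 : R -> R) 0 by exact: is_derive_cst.
  by have := is_deriveB H0 H; rewrite sub0r.
- by exists 0; [exact: is_derive_cst|rewrite normr0].
Qed.

Section model.
Context {R : realType} {d : measure_display} {T : measurableType d}
  {P : R -> probability T R} {m n : nat}
  {u : 'I_m -> {mfun T >-> R}} {v : 'I_n -> {mfun T >-> R}}
  {y : 'I_m -> 'I_n -> {mfun T >-> bool}}.
Hypothesis model : forall lambda, crossed_logistic_model lambda (P lambda) u v y.

Let G := sigma_generated (effects u v).

Definition success (lambda : R) (k : 'I_m * 'I_n) (w : T) : R :=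
  sigmoid (lambda + (u k.1 w + v k.2 w)).

Definition answers_prob (lambda : R) (a : 'I_m * 'I_n -> option bool) (w : T) : R :=
  \prod_k answer_prob (a k) (success lambda k w).

Lemma effects_measurable : G `<=` measurable.
Proof.
apply: smallest_sub; first exact: sigma_algebra_measurable.
move=> A [k _ [B mB <-]]; exact: measurable_funPT.
Qed.

Lemma response_measurable k B : measurable (y k.1 k.2 @^-1` B).
Proof. by rewrite -[X in measurable X]setTI; exact: measurable_funPT. Qed.

Lemma effects_law lambda k A : measurable A ->
  P lambda (effects u v k @^-1` A) = standard_normal R A.
Proof. by move=> mA; exact: (effects_normal (model lambda) k mA). Qed.

Lemma answer_cond_prob lambda (a : option bool) k :
  is_cond_prob (P lambda) G (y k.1 k.2 @^-1` answer_set a)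
    (fun w => answer_prob a (success lambda k w)).
Proof.
have [q [qc qE]] := responses_logit (model lambda) k.1 k.2.
have {qE} qE : q = success lambda k.
  apply/funext => w; have [q01 ql] := qE w.
  by rewrite /success (logit_sigmoid _ _ _ q01 ql) addrA.
rewrite {}qE in qc.
case: a => [[|]|] /=.
- exact: qc.
- have -> : y k.1 k.2 @^-1` [set false] = ~` [set w | y k.1 k.2 w = true].
    by apply/seteqP; split => w /=; case: (y _ _ w).
  apply: is_cond_prob_setC => //; first exact: effects_measurable.
  exact: (response_measurable k [set true]).
- rewrite preimage_setT; apply: is_cond_prob_setT; last exact: effects_measurable.
  exact: smallest_sigma_algebra.
Qed.

Lemma answers_cond_prob lambda (a : 'I_m * 'I_n -> option bool) :
  is_cond_prob (P lambda) G (\bigcap_k (y k.1 k.2 @^-1` answer_set (a k)))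
    (answers_prob lambda a).
Proof.
apply: (@responses_cond_independent _ _ _ _ _ _ _ _ _ _ (model lambda)
  (fun k => answer_set (a k))
  (fun k w => answer_prob (a k) (success lambda k w))) => // k.
exact: answer_cond_prob.
Qed.

Lemma answers_prob01 lambda a w : 0 <= answers_prob lambda a w <= 1.
Proof.
rewrite /answers_prob; elim/big_ind: _ => [|p q /andP[p0 p1] /andP[q0 q1]|k _].
- by rewrite ler01 lexx.
- by rewrite mulr_ge0//= mulr_ile1.
- by apply: answer_prob01; exact: sigmoid01.
Qed.

Lemma measurable_answers_prob lambda a : measurable_fun setT (answers_prob lambda a).
Proof.
have [_ /measurable_int/measurable_EFinP int _] := answers_cond_prob lambda a.
exact: int.
Qed.

Lemma integrable_answers_prob lambda mu a :
  (P mu).-integrable setT (EFin \o answers_prob lambda a).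
Proof.
apply: bounded01_integrable; first exact: measurable_answers_prob.
by move=> w; exact: answers_prob01.
Qed.

Lemma EFin_Rintegral_answers_prob lambda mu a :
  (\int[P mu]_w answers_prob lambda a w)%:E =
  (\int[P mu]_w (answers_prob lambda a w)%:E)%E.
Proof.
rewrite /Rintegral fineK//.
exact: (integrable_fin_num measurableT (integrable_answers_prob lambda mu a)).
Qed.

(** Under every parameter the random effects have the same law, so the integral
    of a function of the effects may be taken under any fixed [P mu]. All the
    dependence on [lambda] is then in the integrand. *)
Lemma answers_probE lambda mu (a : 'I_m * 'I_n -> option bool) :
  P lambda (\bigcap_k (y k.1 k.2 @^-1` answer_set (a k))) =
  (\int[P mu]_w answers_prob lambda a w)%:E.
Proof.
have [qG int_q qE] := answers_cond_prob lambda a.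
rewrite -[X in P _ X]setIT qE; last first.
  by apply: sigma_algebra_setT; exact: smallest_sigma_algebra.
rewrite EFin_Rintegral_answers_prob.
apply: (@sigma_generated_integral_unique _ _ _ _ (effects u v) (P lambda) (P mu)
  (standard_normal R)) => //.
- exact: effects_independent.
- exact: effects_independent.
- exact: effects_law.
- exact: effects_law.
- by move=> w; case/andP: (answers_prob01 lambda a w).
- exact: measurable_answers_prob.
Qed.

(** Differentiation under the integral sign: by [prod_derive_bounded] the
    derivative of the integrand is bounded by the number of responses. *)
Lemma derivable_answers_prob (mu x : R) (a : 'I_m * 'I_n -> option bool) :
  derivable (fun lambda => \int[P mu]_w answers_prob lambda a w) x 1.
Proof.
have dk (w : T) (z : R) : exists2 D, is_derive z 1 (fun l => answers_prob l a w) D &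
    `|D| <= (size (index_enum ('I_m * 'I_n)%type))%:R.
  apply: prod_derive_bounded => k; last exact: derive_answer_prob_bounded.
  by apply: answer_prob01; exact: sigmoid01.
pose c : R := (size (index_enum ('I_m * 'I_n)%type))%:R.
apply: (@derivable_under_integral _ _ _ (P mu) (fun l w => answers_prob l a w)
  setT measurableT x (x - 1) (x + 1) _ _ _ (fun=> c)).
- by rewrite /= in_itv/= ltrBlDr ltrDl ltr01.
- by move=> l _; exact: integrable_answers_prob.
- by move=> l w _ _; have [D []] := dk w l.
- by move=> w; rewrite ler0n.
- apply: measurable_bounded_integrable => //.
    by rewrite (le_lt_trans (probability_le1 _ _)) ?ltry.
  exists c; split; [exact: num_real|move=> z cz w _ /=].
  by rewrite ger0_norm ?ler0n// ltW.
- move=> l w _ _; rewrite partial1of2E; have [D dD Dc] := dk w l.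
  by rewrite derive_val.
Qed.

Lemma responses_bigcap (y0 : 'M[bool]_(m, n)) :
  [set w | responses y w = y0] =
  \bigcap_k (y k.1 k.2 @^-1` answer_set (Some (y0 k.1 k.2))).
Proof.
apply/seteqP; split => w /=; first by move=> <- k _ /=; rewrite mxE.
by move=> H; apply/matrixP => i j; rewrite mxE; exact: (H (i, j)).
Qed.

Lemma measurable_responses_eq (y0 : 'M[bool]_(m, n)) :
  measurable [set w | responses y w = y0].
Proof.
rewrite responses_bigcap; apply: fin_bigcap_measurable => // k _.
exact: response_measurable.
Qed.

Lemma responses_measurable (Q : set 'M[bool]_(m, n)) :
  measurable [set w | Q (responses y w)].
Proof.
rewrite (_ : [set w | _] = \bigcup_(y0 in Q) [set w | responses y w = y0]).
  apply: fin_bigcup_measurable => // y0 _; exact: measurable_responses_eq.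
apply/seteqP; split => [w Qw|w [y0 Qy0 /= wy0]]; first by exists (responses y w).
by rewrite /= wy0.
Qed.

Lemma likelihood_ge0 (y0 : 'M[bool]_(m, n)) lambda : 0 <= likelihood P y y0 lambda.
Proof. exact: fine_ge0. Qed.

Lemma responses_prob lambda (Q : pred 'M[bool]_(m, n)) :
  P lambda [set w | Q (responses y w)] =
  (\sum_(y0 | Q y0) likelihood P y y0 lambda)%:E.
Proof.
pose s := [seq y0 <- index_enum 'M[bool]_(m, n) | Q y0].
have us : uniq s by rewrite filter_uniq// index_enum_uniq.
have -> : [set w | Q (responses y w)] =
    \bigcup_(y0 in [set` s]) [set w | responses y w = y0].
  apply/seteqP; split => [w Qw|w [y0 /= ys wy0]].
    by exists (responses y w) => //=; rewrite mem_filter Qw mem_index_enum.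
  by move: ys; rewrite /= wy0 mem_filter => /andP[].
rewrite measure_fin_bigcup; first last.
- by move=> y0 _; exact: measurable_responses_eq.
- by move=> y1 y2 _ _ [w [/= <- <-]].
- exact: finite_seq.
rewrite -fsbig_seq// big_filter -sumEFin; apply: eq_bigr => y0 _.
by rewrite /likelihood fineK// fin_num_measure//; exact: measurable_responses_eq.
Qed.

Lemma likelihoodE (mu lambda : R) (y0 : 'M[bool]_(m, n)) :
  likelihood P y y0 lambda =
  \int[P mu]_w answers_prob lambda (fun k => Some (y0 k.1 k.2)) w.
Proof. by rewrite /likelihood responses_bigcap (answers_probE lambda mu). Qed.

Lemma derivable_likelihood (x : R) (y0 : 'M[bool]_(m, n)) :
  derivable (likelihood P y y0) x 1.
Proof.
rewrite (_ : likelihood P y y0 = fun lambda =>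
  \int[P x]_w answers_prob lambda (fun k => Some (y0 k.1 k.2)) w).
  exact: derivable_answers_prob.
by apply/funext => lambda; exact: likelihoodE.
Qed.

Lemma answers_prob_one lambda k w :
  answers_prob lambda (fun l => if l == k then Some true else None) w =
  success lambda k w.
Proof.
rewrite /answers_prob (bigD1 k)//= eqxx big1 ?mulr1//.
by move=> l /negbTE ->.
Qed.

Lemma answers_prob_two lambda k k' w : k != k' ->
  answers_prob lambda
    (fun l => if (l == k) || (l == k') then Some true else None) w =
  success lambda k w * success lambda k' w.
Proof.
move=> kk'; rewrite /answers_prob (bigD1 k)//= eqxx (bigD1 k') 1?eq_sym//=.
rewrite eqxx orbT big1 ?mulr1// => l /andP[/negbTE -> /negbTE ->].
by [].
Qed.

Lemma measurable_sum_effects lambda :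
  measurable_fun setT (fun z : R * R => sigmoid (lambda + (z.1 + z.2))).
Proof.
by apply: measurable_shifted_sigmoid; exact: measurable_funD.
Qed.

Lemma EFin_success_rate lambda :
  (success_rate lambda)%:E =
  (\int[standard_normal R \x standard_normal R]_z
     (sigmoid (lambda + (z.1 + z.2)))%:E)%E.
Proof. by rewrite -mean_sigmoidE//; exact: measurable_funD. Qed.

Lemma response_rate lambda k :
  \sum_(y0 : 'M[bool]_(m, n) | y0 k.1 k.2) likelihood P y y0 lambda =
  success_rate lambda.
Proof.
apply/EFin_inj; rewrite -responses_prob.
transitivity (P lambda (\bigcap_l (y l.1 l.2 @^-1`
    answer_set (if l == k then Some true else None)))).
  congr (P lambda _); apply/seteqP; split => w /=; rewrite mxE.
    by move=> yk l _ /=; case: eqP => // ->.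
  by move=> /(_ k Logic.I)/=; rewrite eqxx.
rewrite (answers_probE lambda lambda) EFin_Rintegral_answers_prob.
under eq_integral do rewrite answers_prob_one.
rewrite EFin_success_rate.
rewrite -(@pair_expectation _ _ _ _ (effects u v) (P lambda) _ _ _ _ _ _
  (inl k.1) (inr k.2))//.
- exact: effects_independent.
- exact: effects_law.
- exact: measurable_sum_effects.
- by move=> z; rewrite ltW ?sigmoid_gt0.
Qed.

(** Responses in distinct rows and distinct columns involve disjoint pairs of
    effects, so they are independent unconditionally as well. *)
Lemma two_responses_rate lambda k k' : k.1 != k'.1 -> k.2 != k'.2 ->
  \sum_(y0 : 'M[bool]_(m, n) | y0 k.1 k.2 && y0 k'.1 k'.2)
    likelihood P y y0 lambda =
  success_rate lambda ^+ 2.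
Proof.
move=> k1 k2; have kk' : k != k' by apply: contraNneq k1 => ->.
apply/EFin_inj.
rewrite -(responses_prob lambda (fun y0 => y0 k.1 k.2 && y0 k'.1 k'.2)).
transitivity (P lambda (\bigcap_l (y l.1 l.2 @^-1`
    answer_set (if (l == k) || (l == k') then Some true else None)))).
  congr (P lambda _); apply/seteqP; split => w /=; rewrite !mxE.
    by move=> /andP[yk yk'] l _ /=; case: eqP => [->//|_]; case: eqP => // ->.
  move=> H; apply/andP; split.
    by have := H k Logic.I; rewrite /= eqxx.
  by have := H k' Logic.I; rewrite /= eqxx orbT.
rewrite (answers_probE lambda lambda) EFin_Rintegral_answers_prob.
under eq_integral do rewrite answers_prob_two//.
rewrite expr2 EFinM EFin_success_rate.
rewrite -(@two_pairs_expectation _ _ _ _ (effects u v) (P lambda) _ _ _ _ _ _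
  (inl k.1) (inr k.2) (inl k'.1) (inr k'.2))//.
- exact: effects_independent.
- exact: effects_law.
- exact: measurable_sum_effects.
- by move=> z; rewrite ltW ?sigmoid_gt0.
- rewrite /= !inE /= andbT !orbF.
  rewrite (_ : (inl k.1 == inl k'.1) = (k.1 == k'.1))// k1.
  by rewrite (_ : (inr k.2 == inr k'.2) = (k.2 == k'.2))// k2.
Qed.

Definition no_root_near (mu eps : R) (y0 : 'M[bool]_(m, n)) : Prop :=
  ~ exists2 c, `|c - mu| < eps & likelihood_root P y y0 c.

(** If there is no root within [eps] of [mu], the likelihood at [mu] is at most
    the one at [mu - eps] or at [mu + eps]. Each of these events is rare by
    [likelihood_comparison], applied to the diagonal responses: they lie in
    distinct rows and columns, and there are [minn m n] of them. *)
Lemma no_root_near_prob (mu eps : R) : 0 < eps -> (0 < m)%N -> (0 < n)%N ->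
  fine (P mu [set w | no_root_near mu eps (responses y w)]) <=
  (8 / (success_rate mu - success_rate (mu - eps)) ^+ 2 +
   8 / (success_rate mu - success_rate (mu + eps)) ^+ 2) / (minn m n)%:R.
Proof.
move=> e0 m0 n0.
rewrite (_ : [set w | _] =
  [set w | `[< no_root_near mu eps (responses y w) >]]); last first.
  by apply/seteqP; split => w /asboolP.
rewrite (responses_prob mu (fun y0 => `[< no_root_near mu eps y0 >]))/= mulrDl.
pose b (i : 'I_(minn m n)) (y0 : 'M[bool]_(m, n)) :=
  y0 (widen_ord (geq_minl m n) i) (widen_ord (geq_minr m n) i).
have total lambda : \sum_y0 likelihood P y y0 lambda = 1.
  apply/EFin_inj; rewrite -(responses_prob lambda predT).
  rewrite -[RHS](probability_setT (P lambda)).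
  by congr (P lambda _); apply/seteqP; split.
have rate lambda i :
    \sum_(y0 | b i y0) likelihood P y y0 lambda = success_rate lambda.
  exact: (response_rate lambda (_, _)).
have two_rate lambda i j : i != j ->
    \sum_(y0 | b i y0 && b j y0) likelihood P y y0 lambda =
    success_rate lambda ^+ 2.
  by move=> ij; apply: (two_responses_rate lambda (_, _) (_, _)).
have comparison lambda : mu != lambda ->
    \sum_(y0 | likelihood P y y0 mu <= likelihood P y y0 lambda)
      likelihood P y y0 mu
    <= 8 / (success_rate mu - success_rate lambda) ^+ 2 / (minn m n)%:R.
  move=> mulambda; apply: (@likelihood_comparison _ _ (likelihood P y ^~ mu)
      (likelihood P y ^~ lambda) (minn m n) b).
  - by move=> y0; exact: likelihood_ge0.
  - by move=> y0; exact: likelihood_ge0.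
  - exact: total.
  - exact: total.
  - exact: rate.
  - exact: rate.
  - exact: two_rate.
  - exact: two_rate.
  - move: mulambda; rewrite neq_lt => /orP[] /(success_rate_lt R) ml.
      by apply/negbT; exact: lt_eqF.
    by apply/negbT; exact: gt_eqF.
  - by rewrite leq_min m0 n0.
apply: le_trans (lerD (comparison (mu - eps) _) (comparison (mu + eps) _));
  last 2 first.
- by rewrite -subr_eq0 opprB addrCA subrr addr0 gt_eqF.
- by rewrite -subr_eq0 opprD addrA subrr sub0r oppr_eq0 gt_eqF.
rewrite [leLHS]big_mkcond [X in _ <= X + _]big_mkcond [X in _ <= _ + X]big_mkcond.
rewrite -big_split/=; apply: ler_sum => y0 _.
have L0 := likelihood_ge0 y0 mu.
case: asboolP => [noroot|_]; last by rewrite addr_ge0//; case: ifP.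
case: ifPn => [_|]; first by rewrite lerDl; case: ifP.
rewrite -ltNge => Ll; rewrite ifT ?add0r// leNgt; apply/negP => Lr; apply: noroot.
apply: log_critical_point => //.
- by move=> x; exact: derivable_likelihood.
- by move=> x; exact: likelihood_ge0.
Qed.

End model.

Theorem theorem1 (R : realType)
    (d : nat -> nat -> measure_display)
    (Omega : forall m n : nat, measurableType (d m n))
    (P : forall m n : nat, R -> probability (Omega m n) R)
    (u : forall m n : nat, 'I_m -> {mfun Omega m n >-> R})
    (v : forall m n : nat, 'I_n -> {mfun Omega m n >-> R})
    (y : forall m n : nat, 'I_m -> 'I_n -> {mfun Omega m n >-> bool})
    (model : forall m n : nat, (0 < m)%N -> (0 < n)%N -> forall lambda : R,
       crossed_logistic_model lambda (P m n lambda) (u m n) (v m n) (y m n))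
    (mu : R) :
  exists muhat : forall m n : nat, 'M[bool]_(m, n) -> R,
    P mn.1 mn.2 mu
      [set w | likelihood_root (P mn.1 mn.2) (y mn.1 mn.2)
                 (responses (y mn.1 mn.2) w)
                 (muhat mn.1 mn.2 (responses (y mn.1 mn.2) w))]
      @[mn --> filter_prod \oo \oo] --> 1%E
    /\ forall eps : R, 0 < eps ->
       P mn.1 mn.2 mu
         [set w | eps < `|muhat mn.1 mn.2 (responses (y mn.1 mn.2) w) - mu|]
         @[mn --> filter_prod \oo \oo] --> 0%E.
Proof.
pose tol (m n : nat) : R := (minn m n).+1%:R^-1.
pose muhat m n (y0 : 'M[bool]_(m, n)) :=
  nearest_within (tol m n) mu (likelihood_root (P m n) (y m n) y0).
have tol0 m n : 0 < tol m n by rewrite invr_gt0 ltr0n.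
pose C (eps : R) := 8 / (success_rate mu - success_rate (mu - eps)) ^+ 2 +
                    8 / (success_rate mu - success_rate (mu + eps)) ^+ 2.
have bad_prob m n eps (Q : set 'M[bool]_(m, n)) :
    0 < eps -> (0 < m)%N -> (0 < n)%N ->
    Q `<=` no_root_near (P := P m n) (y := y m n) mu eps ->
    0 <= fine (P m n mu [set w | Q (responses (y m n) w)]) <= C eps / (minn m n)%:R.
  move=> e0 m0 n0 Qbad; rewrite fine_ge0//=.
  apply: le_trans (no_root_near_prob (model m n m0 n0) mu eps e0 m0 n0).
  apply: fine_le; rewrite ?fin_num_measure//; try exact: responses_measurable.
  apply: le_measure; rewrite ?inE; try exact: responses_measurable.
  by move=> w /Qbad.
have fin_P m n (Q : set 'M[bool]_(m, n)) :
    P m n mu [set w | Q (responses (y m n) w)] \is a fin_num.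
  by rewrite fin_num_measure//; exact: responses_measurable.
exists muhat; split.
- apply/fine_cvgP; split.
    apply: nearW => -[m n].
    exact: (fin_P m n (fun y0 => likelihood_root (P m n) (y m n) y0 (muhat m n y0))).
  pose noroot m n (y0 : 'M[bool]_(m, n)) :=
    ~ likelihood_root (P m n) (y m n) y0 (muhat m n y0).
  rewrite (_ : fine \o _ = fun mn => 1 -
      fine (P mn.1 mn.2 mu [set w | noroot mn.1 mn.2 (responses (y mn.1 mn.2) w)])).
    rewrite -[X in _ --> X]subr0; apply: cvgB; first exact: cvg_cst.
    apply: (@cvg_minn _ _ (C 1) 0) => m n m0 n0 /=.
    (* The radius 1 is arbitrary: [muhat] is a root as soon as there is one. *)
    apply: (bad_prob m n 1 (noroot m n)) => // y0 nr [c _ croot]; apply: nr.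
    by have [] := nearest_withinP _ _ mu c _ (tol0 m n) croot.
  apply/funext => -[m n] /=.
  set A := [set w | noroot m n _].
  rewrite (_ : [set w | _] = ~` A); last first.
    by apply/seteqP; split => w /=; [move=> r; apply; exact: r|exact: contrapT].
  have mA : measurable A by exact: responses_measurable.
  by rewrite probability_setC// fineB// (fin_P m n (noroot m n)).
- move=> eps e0.
  (* Beyond [N] the tolerance is at most [eps / 2], so that a root within
     [eps / 2] of [mu] brings [muhat] within [eps]. *)
  pose N := Num.truncn (2 / eps).
  have e20 : 0 < eps / 2 by rewrite divr_gt0.
  apply/fine_cvgP; split.
    apply: nearW => -[m n].
    exact: (fin_P m n (fun y0 => eps < `|muhat m n y0 - mu|)).
  apply: (@cvg_minn _ _ (C (eps / 2)) N) => m n Nm Nn /=.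
  apply: (bad_prob m n (eps / 2) (fun y0 => eps < `|muhat m n y0 - mu|)) => //.
  + exact: leq_ltn_trans Nm.
  + exact: leq_ltn_trans Nn.
  move=> y0 /= far [c cnear croot].
  have [_ near] := nearest_withinP _ _ mu c _ (tol0 m n) croot.
  have tol_small : tol m n <= eps / 2.
    rewrite /tol -[leRHS]invrK lef_pV2 ?posrE ?invr_gt0 ?ltr0n// invf_div.
    rewrite (le_trans (ltW (truncnS_gt _)))// ler_nat ltnS ltnW//.
    by rewrite leq_min Nm Nn.
  rewrite /muhat in far; lra.
Qed.
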